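(* Let $p$, $p_n$, $q_n$ ($n \in \mathbb{N}$) be pairwise distinct primes, and let $u_n, x_n$ ($n \in \mathbb{N}$) be linearly independent elements of a $\mathbb{Q}$-vector space. For each $n \in \mathbb{N}$ let $$B_n = \left\langle p^{-\infty} u_n,\ p_n^{-\infty} x_n,\ q_n^{-1}(u_n + x_n) \right\rangle,$$ and let $G = \bigoplus_{n \in \mathbb{N}} B_n$. Then $G$ is a countable group that does not possess a Main Decomposition.
   Context: For an element $a$ of a $\mathbb{Q}$-vector space and a prime $r$, the symbol $r^{-\infty} a$ inside angle brackets stands for all the elements $r^{-k} a$, $k = 0, 1, 2, \dots$; angle brackets denote the subgroup generated. A torsion-free abelian group is completely decomposable if it is a direct sum (possibly infinite, possibly empty) of groups of rank $1$; it is clipped if it has no direct summand of rank $1$. A Main Decomposition of a torsion-free abelian group $G$ is a decomposition $G = A \oplus H$ in which $A$ is completely decomposable and $H$ is clipped. *)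

(* Defs.v *)
From HB Require Import structures.
From mathcomp Require Import all_boot all_order all_algebra.
From mathcomp Require Import boolp classical_sets cardinality.

Set Implicit Arguments.
Unset Strict Implicit.
Unset Printing Implicit Defensive.

Import GRing.Theory.

Local Open Scope ring_scope.
Local Open Scope classical_set_scope.

(* A torsion-free abelian group is represented as a subgroup, i.e. a set [A]
   with [is_subgroup A], of a Q-vector space [V].  Torsion-freeness is
   automatic, and every torsion-free abelian group embeds in such a [V]. *)

Section TorsionFreeGroups.
Variable V : lmodType rat.
Implicit Types A G H S : set V.

Definition is_subgroup A : Prop :=
  A 0 /\ forall a b, A a -> A b -> A (a - b).

(* The subgroup generated by [S]. *)
Definition gen S : set V := smallest is_subgroup S.

Definition direct_sum (I : Type) (B : I -> set V) G : Prop :=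
  [/\ forall i, is_subgroup (B i),
      forall i, B i `&` gen (\bigcup_(j in [set~ i]) B j) = [set 0] &
      G = gen (\bigcup_i B i)].

Definition direct_sum2 A H G : Prop :=
  [/\ is_subgroup A, is_subgroup H, A `&` H = [set 0] &
      G = [set a + h | a in A & h in H]].

Definition direct_summand A G : Prop := exists H, direct_sum2 A H G.

Definition int_independent (I : finType) (v : I -> V) : Prop :=
  forall c : I -> int, \sum_i v i *~ c i = 0 -> forall i, c i = 0.

(* The rank is the size of a maximal independent system; [oapp v b] is the
   system [v] with [b] adjoined. *)
Definition has_rank A (k : nat) : Prop :=
  exists v : 'I_k -> V,
    [/\ forall i, A (v i), int_independent v &
        forall b, A b -> ~ int_independent (oapp v b)].

Definition completely_decomposable A : Prop :=
  exists (I : Type) (C : I -> set V),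
    (forall i, has_rank (C i) 1) /\ direct_sum C A.

Definition clipped H : Prop :=
  forall A, direct_summand A H -> ~ has_rank A 1.

Definition main_decomposition G A H : Prop :=
  [/\ direct_sum2 A H G, completely_decomposable A & clipped H].

Definition lin_independent (I : eqType) (v : I -> V) : Prop :=
  forall (s : seq I) (c : I -> rat), uniq s ->
    \sum_(i <- s) c i *: v i = 0 -> forall i, i \in s -> c i = 0.

Definition join_family (u x : nat -> V) (i : nat + nat) : V :=
  match i with inl n => u n | inr n => x n end.

(* The elements abbreviated r^(-oo) a inside angle brackets. *)
Definition inf_div (r : nat) (a : V) : set V :=
  range (fun k : nat => (r%:R ^- k : rat) *: a).

Definition Bgroup (p : nat) (p_ q_ : nat -> nat) (u x : nat -> V) (n : nat) :
    set V :=
  gen (inf_div p (u n) `|` inf_div (p_ n) (x n)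
       `|` [set ((q_ n)%:R^-1 : rat) *: (u n + x n)]).

End TorsionFreeGroups.

Section Directness.
Variables (V : lmodType rat) (u x : nat -> V).
Hypothesis indep : lin_independent (join_family u x).

Let comb (a b : nat -> rat) (N : nat) : V :=
  \sum_(n < N) (a n *: u n + b n *: x n).

(* Combinations, over finitely many indices satisfying P, of the u_n, x_n. *)
Let span (P : set nat) : set V := [set v | exists a b : nat -> rat,
  (forall n, ~ P n -> a n = 0 /\ b n = 0) /\
  exists N0, forall N, (N0 <= N)%N -> comb a b N = v].

Let span_subgroup P : is_subgroup (span P).
Proof.
split.
  exists (fun=> 0), (fun=> 0); split=> //; exists 0 => N _.
  by rewrite /comb big1 // => n _; rewrite !scale0r addr0.
move=> v w [a [b [ab [N hN]]]] [c [d [cd [M hM]]]].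
exists (fun n => a n - c n), (fun n => b n - d n); split.
  move=> n nP; have [-> ->] := ab n nP; have [-> ->] := cd n nP.
  by rewrite subr0.
exists (maxn N M) => K; rewrite geq_max => /andP[NK MK].
rewrite -(hN K NK) -(hM K MK) /comb -sumrB; apply: eq_bigr => n _.
by rewrite !scalerBl opprD addrACA.
Qed.

Let span1 (P : set nat) n (a b : rat) :
  P n -> span P (a *: u n + b *: x n).
Proof.
move=> Pn; exists (fun m => if m == n then a else 0),
  (fun m => if m == n then b else 0); split.
  by move=> m nPm; case: eqP => // e; case: nPm; rewrite e.
exists n.+1 => N nN; rewrite /comb (bigD1 (Ordinal nN)) //= eqxx big1 ?addr0 //.
move=> i ine; have /negbTE -> : nat_of_ord i != n.
  by apply: contraNneq ine => e; apply/eqP; apply: val_inj; exact: e.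
by rewrite !scale0r addr0.
Qed.

Let comb0 a b N : comb a b N = 0 ->
  forall n, (n < N)%N -> a n = 0 /\ b n = 0.
Proof.
move=> h n nN.
pose s : seq (nat + nat) := map inl (iota 0 N) ++ map inr (iota 0 N).
pose c (i : nat + nat) := match i with inl n => a n | inr n => b n end.
have us : uniq s.
  rewrite cat_uniq !map_inj_uniq ?iota_uniq /=; try by move=> ? ? [].
  rewrite andbT; apply/hasPn => _ /mapP[k _ ->]; apply/mapP => -[] //.
have := indep (s := s) (c := c) us; rewrite big_cat !big_map /= => /(_ _) H.
have E : \sum_(i <- iota 0 N) a i *: u i + \sum_(i <- iota 0 N) b i *: x i = 0.
  have := h; rewrite /comb -(big_mkord xpredT (fun n => a n *: u n + b n *: x n)).
  by rewrite big_split /= /index_iota subn0.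
have nI : n \in iota 0 N by rewrite mem_iota.
split.
- by apply: (H E (inl n)); rewrite mem_cat map_f.
- by apply: (H E (inr n)); rewrite mem_cat (map_f inr) ?orbT.
Qed.

Let span_disj (P Q : set nat) (v : V) :
  (forall n, P n -> ~ Q n) -> span P v -> span Q v -> v = 0.
Proof.
move=> PQ [a [b [ab [N hN]]]] [c [d [cd [M hM]]]].
pose K := maxn N M.
have e1 := hN K (leq_maxl _ _); have e2 := hM K (leq_maxr _ _).
have h : comb (fun n => a n - c n) (fun n => b n - d n) K = 0.
  rewrite -(subrr v) -[in X in X - _]e1 -[in X in _ - X]e2 /comb -sumrB.
  by apply: eq_bigr => n _; rewrite !scalerBl opprD addrACA.
rewrite -e1 /comb big1 // => -[n nK] _ /=.
have [/eqP] := comb0 h nK; rewrite !subr_eq0 => /eqP ea /eqP; rewrite subr_eq0 => /eqP eb.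
case: (pselect (P n)) => [/PQ/cd[c0 d0]|/ab[a0 b0]].
  by rewrite ea eb c0 d0 !scale0r addr0.
by rewrite a0 b0 !scale0r addr0.
Qed.

Let gen_subgroup (S : set V) : is_subgroup (gen S).
Proof.
split; first by move=> A [[]].
by move=> a b ha hb A hA; case: (hA) => -[_ h] _; apply: h; [apply: ha|apply: hb].
Qed.

Let Bspan p p_ q_ n (P : set nat) : P n -> Bgroup p p_ q_ u x n `<=` span P.
Proof.
move=> Pn; apply: smallest_sub; first exact: span_subgroup.
move=> _ [[[k _ <-]|[k _ <-]]|->].
- by rewrite -[X in span P X]addr0 -(scale0r (x n)); exact: span1.
- by rewrite -[X in span P X]add0r -(scale0r (u n)); exact: span1.
- by rewrite scalerDr; exact: span1.
Qed.

(* The sum of the groups B_n inside [V] is direct, so that their direct sum can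
   be taken to be an internal one. *)
Lemma direct_sum_Bgroup p p_ q_ :
  direct_sum (Bgroup p p_ q_ u x) (gen (\bigcup_n Bgroup p p_ q_ u x n)).
Proof.
split=> // [n|n]; first exact: gen_subgroup.
apply/seteqP; split=> [v [Bv gv]|_ ->]; last first.
  by split; exact: (gen_subgroup _).1.
apply: (@span_disj [set n] [set~ n]); first by move=> m /= -> /(_ erefl).
  exact: (Bspan (erefl : [set n] n) Bv).
move: v gv {Bv}; apply: smallest_sub; first exact: span_subgroup.
by move=> v [j jn Bv]; exact: (Bspan jn Bv).
Qed.

End Directness.

(* Main.v *)
Require Import Defs.
From mathcomp Require Import all_boot all_order all_algebra.
From mathcomp Require Import ring.
From mathcomp Require Import boolp classical_sets cardinality.

(* Suppose G = A (+) H is a Main Decomposition.  The p_n-divisible part of G is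
   Z[1/p_n] x_n, so x_n lies in A or in H; it cannot lie in A, for then a rank
   one summand of G would contain x_n, the projection onto it would kill the
   p-divisible u_n, and (u_n + x_n)/q_n would give x_n/q_n in G.  So all x_n are
   in H.  Writing u_n = a_n + h_n, the coefficient of h_n at u_n is 1 modulo
   q_n, hence nonzero, so the intersection of H with U = (+) Z[1/p] u_n has
   infinite rank.  It therefore contains an integral combination
   w = sum w_n u_n with gcd (q_n w_n) = 1.  If sum q_n w_n D_n = 1, then
   u_n |-> q_n D_n, x_n |-> 0 maps G to Z[1/p] and w to 1, which splits the rank
   one summand Z[1/p] w off H: H is not clipped. *)

Import Order.TTheory GRing.Theory Num.Theory.

Local Open Scope ring_scope.
Local Open Scope classical_set_scope.

(** * Localizations of the integers *)

Section Localization.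
Set Implicit Arguments.
Unset Strict Implicit.

(** This is the ring Z[1/p], in which [p] becomes invertible, and not the localization at the prime
    ideal of [p]. *)
Definition Zloc (p : nat) : set rat :=
  [set y | exists k, y * p%:R ^+ k \is a Num.int].

Lemma Zloc_int p y : y \is a Num.int -> Zloc p y.
Proof. by exists 0; rewrite expr0 mulr1. Qed.

Lemma ZlocB p y z : Zloc p y -> Zloc p z -> Zloc p (y - z).
Proof.
move=> [k yk] [l zl]; exists (k + l); rewrite mulrBl exprD mulrA.
by rewrite [_ ^+ k * _]mulrC mulrA rpredB // rpredM // rpredX // rpred_nat.
Qed.

Lemma ZlocD p y z : Zloc p y -> Zloc p z -> Zloc p (y + z).
Proof.
move=> hy hz; rewrite -[z]opprK -[- z]sub0r; apply: ZlocB => //.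
by apply: ZlocB => //; apply: Zloc_int; rewrite rpred0.
Qed.

Lemma ZlocM p y z : Zloc p y -> Zloc p z -> Zloc p (y * z).
Proof.
move=> [k yk] [l zl]; exists (k + l).
by rewrite exprD mulrACA rpredM.
Qed.

Lemma Zloc_sum p N (F : nat -> rat) :
  (forall n, (n < N)%N -> Zloc p (F n)) -> Zloc p (\sum_(n < N) F n).
Proof.
elim: N => [|N IH] h; first by rewrite big_ord0; apply: Zloc_int; rewrite rpred0.
by rewrite big_ord_recr; apply: ZlocD;
  [apply: IH => n nN; apply: h; apply: ltnW|apply: h].
Qed.

Lemma Zloc_expV p k : prime p -> Zloc p (p%:R ^- k).
Proof.
move=> pp; exists k; rewrite mulVf ?rpred1 // expf_neq0 // pnatr_eq0.
by rewrite -lt0n prime_gt0.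
Qed.

Lemma prime_neq0 p : prime p -> p%:R != 0 :> rat.
Proof. by move=> /prime_gt0; rewrite pnatr_eq0 lt0n. Qed.

Lemma dvdz_primeM r a b : prime r -> (r%:Z %| a * b)%Z -> (r%:Z %| a)%Z || (r%:Z %| b)%Z.
Proof. by move=> pr; rewrite !dvdzE abszM Euclid_dvdM. Qed.

Lemma Zloc_divP p q (k : int) : prime p -> prime q -> p <> q ->
  Zloc p (k%:~R / q%:R) -> (q%:Z %| k)%Z.
Proof.
move=> pp pq npq [j /intrP[z hz]].
have e : k * p%:Z ^+ j = z * q%:Z.
  apply/eqP; rewrite -(eqr_int rat) !rmorphM rmorphXn /= -hz -!pmulrn.
  by have := prime_neq0 pq; move: (q%:R) => Q Q0; apply/eqP; field.
have : (q%:Z %| k * p%:Z ^+ j)%Z by rewrite e dvdz_mull.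
case/(dvdz_primeM pq)/orP => //.
rewrite !dvdzE abszX /= Euclid_dvdX //.
by rewrite dvdn_prime2 // => /andP[/eqP /esym].
Qed.

Lemma Zloc_inf_div r s y : prime r -> prime s -> r <> s ->
  (forall k, Zloc s (r%:R ^- k * y)) -> y = 0.
Proof.
move=> pr ps rs h; suff: numq y = 0 by move/eqP; rewrite numq_eq0 => /eqP.
apply/eqP; rewrite -absz_eq0 -leqn0 leqNgt; apply/negP => n0.
(* The exponent is the absolute value [k] of the numerator of [y] itself: then [r ^ k] divides
   [k * s ^ j], hence [k], although [r ^ k] exceeds [k]. *)
have [j /intrP[z hz]] := h `|numq y|%N.
set k := `|numq y|%N in hz n0.
have e : numq y * s%:Z ^+ j = z * denq y * r%:Z ^+ k.
  apply/eqP; rewrite -(eqr_int rat) !rmorphM !rmorphXn /= -hz numqE -!pmulrn.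
  have := expf_neq0 k (prime_neq0 pr).
  move: (r%:R ^+ k) => R; move: (s%:R ^+ j) => S; move=> R0.
  by apply/eqP; field.
have : (r ^ k %| k * s ^ j)%N.
  have := congr1 absz e; rewrite !abszM !abszX /= -/k => ->.
  by rewrite dvdn_mull.
rewrite Gauss_dvdl; last first.
  by rewrite coprimeXl // coprimeXr // prime_coprime // dvdn_prime2 //; apply/eqP.
by move/(dvdn_leq n0); rewrite leqNgt ltn_expl // prime_gt1.
Qed.

End Localization.

(** * Unimodular vectors *)

Section Unimodular.
Set Implicit Arguments.
Unset Strict Implicit.

Lemma dvdz_sum (r : int) N (F : nat -> int) :
  (forall n, (n < N)%N -> (r %| F n)%Z) -> (r %| \sum_(n < N) F n)%Z.
Proof. by move=> h; apply: rpred_sum => i _; apply: h. Qed.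

(** Iterated Bezout: the combination is, up to sign, the gcd of the first [N] values of [c]. The old
    coefficients are rescaled whenever a new value enters. *)
Lemma bezout_sum (c : nat -> int) N : exists d : nat -> int,
  forall n, (n < N)%N -> (\sum_(k < N) c k * d k %| c n)%Z.
Proof.
elim: N => [|N [d hd]]; first by exists (fun=> 0).
have [v [w e]] := Bezoutz (\sum_(k < N) c k * d k) (c N).
exists (fun k => if (k < N)%N then v * d k else w) => n nN.
have -> : \sum_(k < N.+1) c k * (if (k < N)%N then v * d k else w) =
    gcdz (\sum_(k < N) c k * d k) (c N).
  rewrite big_ord_recr /= ltnn -e mulr_sumr [c N * w]mulrC; congr (_ + _).
  by apply: eq_bigr => i _; rewrite ltn_ord mulrCA.
case: (ltngtP n N) nN => [nN _|nN|-> _]; last exact: dvdz_gcdr.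
  by apply: dvdz_trans (hd n nN); exact: dvdz_gcdl.
by rewrite ltnS leqNgt nN.
Qed.

(** Clear denominators by [D], then divide by the gcd [g], which is nonzero because of [f m != 0].
    The Bezout coefficients [d] give an integral functional with value 1 on [e], so [e] does not
    vanish modulo any prime. *)
Lemma primitive_multiple (f : nat -> rat) N m :
  (forall n, (N <= n)%N -> f n = 0) -> f m != 0 ->
  exists (t : rat) (e d : nat -> int),
    [/\ t != 0, forall n, (e n)%:~R = t * f n & \sum_(k < N) e k * d k = 1].
Proof.
move=> fN fm; pose D : int := \prod_(k < N) denq (f k).
have D0 : D != 0 by apply/prodf_neq0 => i _; exact: denq_neq0.
have [c hc] : exists c : nat -> int, forall n, (c n)%:~R = D%:~R * f n.
  exists (fun n => numq (D%:~R * f n)) => n.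
  case: (ltnP n N) => [nN|/fN ->]; last by rewrite mulr0.
  have /intrP[z ->] : D%:~R * f n \is a Num.int; last by rewrite numq_int.
  rewrite /D (bigD1 (Ordinal nN)) //= rmorphM /= mulrAC [_ * f n]mulrC -numqE.
  by rewrite rpredM ?rpred_int.
have [d hd] := bezout_sum c N; set g := \sum_(k < N) _ in hd.
have mN : (m < N)%N by rewrite ltnNge; apply: contra fm => /fN ->.
have cm : c m != 0 by rewrite -(intr_eq0 rat) hc mulf_neq0 // intr_eq0.
have g0 : g != 0 by apply: contraNneq cm => g0; move: (hd m mN); rewrite g0 dvd0z.
have gq : g%:~R != 0 :> rat by rewrite intr_eq0.
have hg n : (g %| c n)%Z.
  case: (ltnP n N) => [/hd //|/fN fn]; suff -> : c n = 0 by exact: dvdz0.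
  by apply/eqP; rewrite -(intr_eq0 rat) hc fn mulr0.
exists (D%:~R / g%:~R), (fun n => (c n %/ g)%Z), d; split.
- by rewrite mulf_neq0 ?invr_eq0 ?intr_eq0.
- move=> n; apply: (mulIf gq); rewrite -rmorphM /= divzK // hc.
  by field.
- apply: (mulIf g0); rewrite mul1r mulr_suml; apply: eq_bigr => i _.
  by rewrite mulrAC divzK.
Qed.

Lemma prime_divisor_int (g : int) : `|g|%N <> 1%N ->
  exists2 r, prime r & (r%:Z %| g)%Z.
Proof.
move=> g1; case: (posnP `|g|%N) => [g0|gp].
  (* If [g = 0], every prime divides it. *)
  by exists 2; rewrite // dvdzE g0 dvdn0.
exists (pdiv `|g|); last by rewrite dvdzE /= pdiv_dvd.
by apply: pdiv_prime; case: `|g|%N g1 gp => [|[]].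
Qed.

Lemma dvd_prod_primes (q : nat -> nat) r M (P : pred nat) :
  prime r -> (forall n, prime (q n)) ->
  (r%:Z %| (\prod_(m < M | P m) q m)%N%:Z)%Z ->
  exists m, [/\ (m < M)%N, P m & r = q m].
Proof.
move=> pr pq; rewrite dvdzE /= => h.
elim: M h => [|M IH]; first by rewrite big_ord0 dvdn1 => /eqP r1; rewrite r1 in pr.
rewrite big_mkcond big_ord_recr /= -big_mkcond Euclid_dvdM // => /orP[/IH|].
  by move=> [m [mM Pm ->]]; exists m; split => //; apply: ltnW.
case: ifP => [PM|_]; last by rewrite dvdn1 => /eqP r1; rewrite r1 in pr.
by rewrite dvdn_prime2 // => /eqP ->; exists M.
Qed.

Lemma prod_primes_dvd (q : nat -> nat) m M (P : pred nat) :
  (m < M)%N -> P m -> ((q m)%:Z %| (\prod_(m < M | P m) q m)%N%:Z)%Z.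
Proof.
by move=> mM Pm; rewrite dvdzE /= (bigD1 (Ordinal mM)) //= dvdn_mulr.
Qed.

(** Two independent members of [W] yield integral [e] and [f] that stay independent modulo every
    prime, and [w] is a suitable combination of them. A prime dividing all [q n * w n] either
    divides all [w n], or is some [q m] dividing every [w n] with [n <> m]; the coefficients of [w]
    exclude both. *)
Lemma exists_unimodular (q : nat -> nat) (W : set (nat -> rat)) :
  (forall n, prime (q n)) -> injective q ->
  (forall f, W f -> exists N, forall n, (N <= n)%N -> f n = 0) ->
  (forall a b f g, W f -> W g -> W (fun n => a * f n + b * g n)) ->
  (forall n, exists2 f, W f & f n != 0) ->
  exists (w D : nat -> int) M,
    [/\ W (fun n => (w n)%:~R), forall n, (M <= n)%N -> w n = 0 &
        \sum_(n < M) (q n)%:Z * w n * D n = 1].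
Proof.
move=> pq iq Wsupp Wlin Wneq0.
have [f0 Wf0 f00] := Wneq0 0%N; have [N0 hN0] := Wsupp _ Wf0.
(* [N0] lies beyond the support of [f0], so [f1] is not a multiple of [f0]; the same coordinate will
   show that [f2] is nonzero. *)
have [f1 Wf1 f1N] := Wneq0 N0; have [N1 hN1] := Wsupp _ Wf1.
pose M := maxn N0 N1.
have f0M n : (M <= n)%N -> f0 n = 0 by rewrite geq_max => /andP[/hN0].
have f1M n : (M <= n)%N -> f1 n = 0 by rewrite geq_max => /andP[_ /hN1].
have [t0 [e [d [t00 he ed]]]] := primitive_multiple f0M f00.
pose y : rat := \sum_(k < M) f1 k * (d k)%:~R.
(* f2 is in the kernel of the functional d, which maps e to 1. *)
pose f2 n := f1 n - y * (e n)%:~R.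
have eN0 : e N0 = 0 by apply/eqP; rewrite -(intr_eq0 rat) he hN0 // mulr0.
have eM n : (M <= n)%N -> e n = 0.
  by move=> /f0M h; apply/eqP; rewrite -(intr_eq0 rat) he h mulr0.
have f2N0 : f2 N0 != 0 by rewrite /f2 eN0 mulr0 subr0.
have f2M n : (M <= n)%N -> f2 n = 0 by move=> h; rewrite /f2 eM // f1M // mulr0 subr0.
have [t2 [f [d' [t20 hf fd]]]] := primitive_multiple f2M f2N0.
have fM n : (M <= n)%N -> f n = 0.
  by move=> /f2M h; apply/eqP; rewrite -(intr_eq0 rat) hf h mulr0.
have We : W (fun n => (e n)%:~R).
  rewrite (_ : (fun n => _) = fun n => t0 * f0 n + 0 * f0 n); first exact: Wlin.
  by apply/funext => n; rewrite he mul0r addr0.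
have Wf : W (fun n => (f n)%:~R).
  rewrite (_ : (fun n => _) = fun n => t2 * f1 n + (- t2 * y) * (e n)%:~R);
    first exact: Wlin.
  by apply/funext => n; rewrite hf /f2; ring.
have df : \sum_(k < M) f k * d k = 0.
  apply/eqP; rewrite -(intr_eq0 rat) rmorph_sum /=.
  under eq_bigr => k _ do
    rewrite rmorphM /= hf /f2 -mulrA mulrBl -mulrA -[(e k)%:~R * _]rmorphM.
  by rewrite -mulr_sumr sumrB -mulr_sumr -rmorph_sum ed mulr1 subrr mulr0.
(* [P m] says that [e] is, modulo [q m], a multiple of the m-th basis vector. For such [m] the prime
   [q m] divides [s], leaving [t * f] in [w]; otherwise it divides [t], leaving [s * e]. *)
pose P m := [forall n : 'I_M, (n != m :> nat) ==> ((q m)%:Z %| e n)%Z].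
have PP m : reflect (forall n, (n < M)%N -> n <> m -> ((q m)%:Z %| e n)%Z) (P m).
  apply: (iffP forallP) => [h n nM nm|h n].
    by have /implyP := h (Ordinal nM); apply; apply/eqP.
  by apply/implyP => /eqP; apply: h.
pose s := (\prod_(m < M | P m) q m)%N; pose t := (\prod_(m < M | ~~ P m) q m)%N.
have st r : prime r -> (r%:Z %| s%:Z)%Z -> (r%:Z %| t%:Z)%Z -> False.
  move=> pr /(dvd_prod_primes pr pq)[m [mM Pm ->]].
  move=> /(dvd_prod_primes (P := predC P) (pq m) pq)[m' [_ Pm' /iq mm']].
  by move: Pm'; rewrite /= -mm' Pm.
(* Modulo q_m, at most one of e, f is a multiple of the m-th basis vector, as
   they are linearly independent modulo every prime; w is made congruent to a
   unit multiple of one that is not. *)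
pose w n : int := s%:Z * e n + t%:Z * f n.
have wM n : (M <= n)%N -> w n = 0 by move=> h; rewrite /w eM // fM // !mulr0 addr0.
have [D hD] := bezout_sum (fun n => (q n)%:Z * w n) M.
set g := \sum_(k < M) _ in hD.
have Ww : W (fun n => (w n)%:~R).
  rewrite (_ : (fun n => _) = fun n => s%:R * (e n)%:~R + t%:R * (f n)%:~R);
    first exact: Wlin.
  by apply/funext => n; rewrite /w rmorphD !rmorphM.
have dvd1 r : prime r -> (r%:Z %| 1%R)%Z -> False.
  by move=> pr; rewrite dvdzE absz1 dvdn1 /= => /eqP r1; rewrite r1 in pr.
suff g1 : `|g|%N = 1%N.
  (* [g] is 1 or -1, so multiplying [D] by [g] turns the sum into [g * g = 1]. *)
  exists w, (fun n => g * D n), M; split => //.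
  under eq_bigr => k _ do rewrite mulrCA.
  rewrite -mulr_sumr -/g.
  by case: (g) g1 => -[|[|n]].
apply: contrapT => /prime_divisor_int[r pr rg].
have rw n : (n < M)%N -> (r%:Z %| (q n)%:Z * w n)%Z.
  by move=> nM; apply: dvdz_trans (hD n nM).
(* If [r] divides all of [w], pairing [w] with [d] gives that [r] divides [s]; then [r] divides
   [t * f], and pairing with [d'] gives that it divides [t]. *)
have [all_w|] := pselect (forall n, (n < M)%N -> (r%:Z %| w n)%Z).
  have rs : (r%:Z %| s%:Z)%Z.
    have : (r%:Z %| \sum_(n < M) w n * d n)%Z.
      by apply: (@dvdz_sum _ _ (fun n => w n * d n)) => n nM; rewrite dvdz_mulr ?all_w.
    under eq_bigr => n _ do rewrite mulrDl -!mulrA.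
    by rewrite big_split -!mulr_sumr /= ed df mulr0 mulr1 addr0.
  apply: (st r) => //.
  have : (r%:Z %| \sum_(n < M) t%:Z * f n * d' n)%Z.
    apply: (@dvdz_sum _ _ (fun n => t%:Z * f n * d' n)) => n nM; apply: dvdz_mulr.
    have := all_w n nM; rewrite /w rpredDl // ; exact: dvdz_mulr.
  under eq_bigr => n _ do rewrite -mulrA.
  by rewrite -mulr_sumr fd mulr1.
move=> /existsNP[m /not_implyP[mM nrw]].
have rq : r = q m.
  have := dvdz_primeM pr (rw m mM); case/orP => // h.
  by move: h; rewrite dvdzE /= dvdn_prime2 // => /eqP.
subst r.
have rw' n : (n < M)%N -> n <> m -> ((q m)%:Z %| w n)%Z.
  move=> nM nm; have /orP[h|//] := dvdz_primeM pr (rw n nM).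
  by rewrite dvdzE /= dvdn_prime2 // in h; case: nm; move/eqP/iq: h.
(* Here both [e] and [f] are multiples of the m-th basis vector modulo [q m]. From the value 1 of
   [d] on [e], [d m] is a unit; from its value 0 on [f], [f m] vanishes, against the value 1 of [d']
   on [f]. *)
have [Pm|nPm] := boolP (P m).
  have qs : ((q m)%:Z %| s%:Z)%Z by exact: prod_primes_dvd.
  have qf n : (n < M)%N -> n <> m -> ((q m)%:Z %| f n)%Z.
    move=> nM nm; have := rw' n nM nm; rewrite /w rpredDl; last exact: dvdz_mulr.
    by move/(dvdz_primeM pr)/orP => -[/(st _ pr qs)|].
  have rest (a b : nat -> int) : (forall n, (n < M)%N -> n <> m -> ((q m)%:Z %| a n)%Z) ->
      ((q m)%:Z %| \sum_(n < M) a n * b n - a m * b m)%Z.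
    move=> h; rewrite (bigD1 (Ordinal mM)) //= addrAC subrr add0r.
    apply: rpred_sum => n nm; apply: dvdz_mulr; apply: h => // e1.
    by move/eqP: nm; apply; apply: val_inj.
  have qd : ~ ((q m)%:Z %| d m)%Z.
    move=> h; apply: (dvd1 _ pr); rewrite -ed.
    have := rest e d (elimT (PP m) Pm); rewrite rpredBr //; exact: dvdz_mull.
  have qfm : ((q m)%:Z %| f m)%Z.
    have := rest f d qf; rewrite df sub0r rpredN.
    by move/(dvdz_primeM pr)/orP => -[].
  apply: (dvd1 _ pr); rewrite -fd.
  by have := rest f d' qf; rewrite rpredBr //; exact: dvdz_mulr.
(* Now [q m] divides [t] but not [s], so it divides [e n] for all [n <> m], which is [P m] after
   all. *)
have qt : ((q m)%:Z %| t%:Z)%Z by exact: (@prod_primes_dvd q m M (predC P)).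
case/negP: nPm; apply/PP => n nM nm.
have := rw' n nM nm; rewrite /w rpredDr; last exact: dvdz_mulr.
by move/(dvdz_primeM pr)/orP => -[/(st _ pr)/(_ qt)|].
Qed.

End Unimodular.

(** * Direct sums *)

Section DirectSums.
Set Implicit Arguments.
Unset Strict Implicit.
Variable V : lmodType rat.
Implicit Types A C G H K S : set V.

Lemma gen_subgroup S : is_subgroup (gen S).
Proof.
split; first by move=> A [[]].
by move=> a b ha hb A hA; case: (hA) => -[_ h] _; apply: h; [apply: ha|apply: hb].
Qed.

Lemma sub_gen S : S `<=` gen S.
Proof. exact: sub_smallest. Qed.

Lemma subgroupN A a : is_subgroup A -> A a -> A (- a).
Proof. by move=> [A0 AB] Aa; rewrite -sub0r; apply: AB. Qed.

Lemma subgroupD A a b : is_subgroup A -> A a -> A b -> A (a + b).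
Proof.
by move=> sA Aa Ab; rewrite -[b]opprK; apply: sA.2 => //; apply: subgroupN.
Qed.

Lemma subgroupMz A a (m : int) : is_subgroup A -> A a -> A (m%:~R *: a).
Proof.
move=> sA Aa; rewrite scaler_int; case: m => m; last first.
  rewrite NegzE mulrNz; apply: subgroupN => //.
  by elim: m.+1 => [|n IH]; [apply: sA.1|rewrite -pmulrn mulrS; apply: subgroupD].
rewrite -pmulrn.
by elim: m => [|n IH]; [apply: sA.1|rewrite mulrS; apply: subgroupD].
Qed.

Lemma subgroup_sum A N (F : nat -> V) : is_subgroup A ->
  (forall n, A (F n)) -> A (\sum_(n < N) F n).
Proof.
move=> sA h; elim: N => [|N IH]; first by rewrite big_ord0; apply: sA.1.
by rewrite big_ord_recr; apply: subgroupD.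
Qed.

Lemma add_subgroup A H : is_subgroup A -> is_subgroup H ->
  is_subgroup [set a + h | a in A & h in H].
Proof.
move=> sA sH; split.
  by exists 0; [exact: sA.1|exists 0; [exact: sH.1|rewrite addr0]].
move=> _ _ [a Aa [h Hh <-]] [b Ab [k Hk <-]].
exists (a - b); first exact: sA.2.
by exists (h - k); [exact: sH.2|rewrite opprD addrACA].
Qed.

Lemma direct_sum2C A H G : direct_sum2 A H G -> direct_sum2 H A G.
Proof.
move=> [sA sH AH ->]; split => //; first by rewrite setIC.
by apply/seteqP; split=> _ [a Aa [h Hh <-]];
  exists h => //; exists a => //; rewrite addrC.
Qed.

Lemma direct_sum2_uniq A H G a h b k : direct_sum2 A H G ->
  A a -> H h -> A b -> H k -> a + h = b + k -> a = b /\ h = k.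
Proof.
move=> [sA sH AH _] Aa Hh Ab Hk e.
have e1 : a - b = k - h.
  by apply/eqP; rewrite subr_eq addrAC eq_sym subr_eq e addrC.
have : (A `&` H) (a - b) by split; [apply: sA.2|rewrite e1; apply: sH.2].
rewrite AH => /= e0; split; apply/eqP; rewrite -subr_eq0; first by apply/eqP.
by rewrite -opprB -e1 e0 oppr0.
Qed.

Lemma direct_sum2_sub A H G : direct_sum2 A H G -> A `<=` G.
Proof.
move=> [_ sH _ ->] a Aa; exists a => //.
by exists 0; [exact: sH.1|rewrite addr0].
Qed.

Lemma direct_sum2_subr A H G : direct_sum2 A H G -> H `<=` G.
Proof. by move/direct_sum2C/direct_sum2_sub. Qed.

(** Decompose the quotient as [b + k] and compare [a + h] with [m b + m k] by uniqueness of
    components. *)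
Lemma direct_sum2_scaleV A H G (m : int) a h : direct_sum2 A H G -> m != 0 ->
  A a -> H h -> G (m%:~R^-1 *: (a + h)) ->
  A (m%:~R^-1 *: a) /\ H (m%:~R^-1 *: h).
Proof.
move=> D m0 Aa Hh Gv; have [sA sH _ GE] := D.
have [b Ab [k Hk e]] : [set a + h | a in A & h in H] (m%:~R^-1 *: (a + h)) by rewrite -GE.
have mq : (m%:~R : rat) != 0 by rewrite intr_eq0.
have e' : a + h = m%:~R *: b + m%:~R *: k by rewrite -scalerDr e scalerA mulfV // scale1r.
have [|||| -> ->] := direct_sum2_uniq D _ _ _ _ e' => //; try exact: subgroupMz.
by rewrite !scalerA mulVf // !scale1r.
Qed.

Lemma direct_sum2_pure A H G (c : rat) a : direct_sum2 A H G ->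
  A a -> G (c *: a) -> A (c *: a).
Proof.
move=> D Aa Ga; have [sA sH _ _] := D.
have e : c *: a = (denq c)%:~R^-1 *: ((numq c)%:~R *: a + 0).
  by rewrite addr0 scalerA [_^-1 * _]mulrC divq_num_den.
have := @direct_sum2_scaleV _ _ _ (denq c) ((numq c)%:~R *: a) 0 D (denq_neq0 _) _ sH.1.
rewrite -e => h; have [|//|h1 _] := h; first exact: subgroupMz.
by move: h1; rewrite scalerA mulrC divq_num_den.
Qed.

(** Used to turn a rank one summand of the completely decomposable part into a summand of the whole
    group. *)
Lemma direct_sum2A C K A H G :
  direct_sum2 C K A -> direct_sum2 A H G ->
  direct_sum2 C [set k + h | k in K & h in H] G.
Proof.
move=> D1 D2; have [sC sK CK AE] := D1; have [sA sH AH GE] := D2.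
split => //; first exact: add_subgroup.
- apply/seteqP; split=> [c [Cc [k Kk [h Hh e]]]|_ ->]; last first.
    split; first exact: sC.1.
    by exists 0; [exact: sK.1|exists 0; [exact: sH.1|rewrite addr0]].
  have Ac := direct_sum2_sub D1 Cc; have Ak := direct_sum2_subr D1 Kk.
  have [] := direct_sum2_uniq D2 Ak Hh Ac sH.1; rewrite ?addr0 // => ekc _.
  by rewrite -CK; split; rewrite // -ekc.
- rewrite GE AE; apply/seteqP; split.
    move=> _ [_ [c Cc [k Kk <-]] [h Hh <-]]; exists c => //.
    exists (k + h); last by rewrite addrA.
    by exists k => //; exists h.
  move=> _ [c Cc [_ [k Kk [h Hh <-]] <-]].
  exists (c + k); last by exists h; rewrite ?addrA.
  by exists c => //; exists k.
Qed.

Lemma direct_sum_split (I : Type) (C : I -> set V) A i :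
  direct_sum C A -> direct_sum2 (C i) (gen (\bigcup_(j in [set~ i]) C j)) A.
Proof.
move=> [sC Cd ->]; split => //; first exact: gen_subgroup.
have sg := gen_subgroup; apply/seteqP; split.
  apply: smallest_sub; first exact: add_subgroup.
  move=> v [j _ Cv]; have [ij|nij] := pselect (j = i).
    by exists v; [rewrite -ij|exists 0; [exact: (sg _).1|rewrite addr0]].
  exists 0; first exact: (sC i).1.
  by exists v; [apply: sub_gen; exists j|rewrite add0r].
move=> _ [c Cc [k Kk <-]]; apply: (subgroupD (sg _)).
  by apply: sub_gen; exists i.
move: k Kk; apply: smallest_sub => [|k]; first exact: sg.
move=> [j _ Cj].
by apply: sub_gen; exists j.
Qed.

(** Indices may repeat; the length is kept as an index so that it can serve as an induction
    measure. *)
Inductive fin_sum (I : Type) (C : I -> set V) : nat -> V -> Prop :=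
| FinSum0 : fin_sum C 0 0
| FinSumS n i y v : C i y -> fin_sum C n v -> fin_sum C n.+1 (y + v).

Lemma fin_sumN (I : Type) (C : I -> set V) n v :
  (forall i, is_subgroup (C i)) -> fin_sum C n v -> fin_sum C n (- v).
Proof.
move=> sC; elim=> [|m i y w Cy _ IH]; first by rewrite oppr0; apply: FinSum0.
by rewrite opprD; apply: FinSumS (subgroupN (sC i) Cy) IH.
Qed.

Lemma fin_sumD (I : Type) (C : I -> set V) n m v w :
  fin_sum C n v -> fin_sum C m w -> fin_sum C (n + m) (v + w).
Proof.
move=> hv hw; elim: hv => [|k i y z Cy _ IH]; first by rewrite add0r.
by rewrite -addrA addSn; apply: FinSumS Cy IH.
Qed.

Lemma gen_fin_sum (I : Type) (C : I -> set V) v :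
  (forall i, is_subgroup (C i)) ->
  gen (\bigcup_i C i) v -> exists n, fin_sum C n v.
Proof.
move=> sC.
suff h : gen (\bigcup_i C i) `<=` [set v | exists n, fin_sum C n v] by apply: h.
apply: smallest_sub => [|{}v [i _ Cv]]; last first.
  by exists 1%N; rewrite -[v]addr0; apply: FinSumS Cv (FinSum0 C).
split=> [|a b [n ha] [m hb]]; first by exists 0%N; apply: FinSum0.
by exists (n + m)%N; apply: fin_sumD => //; apply: fin_sumN.
Qed.

Lemma fin_sum_split (I : Type) (C : I -> set V) n v i :
  (forall i, is_subgroup (C i)) -> fin_sum C n v ->
  exists y w, [/\ C i y, fin_sum C n w,
    gen (\bigcup_(j in [set~ i]) C j) w & v = y + w].
Proof.
move=> sC; have sg := gen_subgroup (\bigcup_(j in [set~ i]) C j).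
elim=> [|m j y w Cy hw [y' [w' [Cy' hw' gw' ->]]]].
  by exists 0, 0; split; [exact: (sC i).1|exact: FinSum0|exact: sg.1|rewrite addr0].
have [ji|nji] := pselect (j = i).
  (* The term [y] is absorbed into the component in [C i], and a padding 0 from [C i] keeps the
     length of the remainder unchanged. *)
  exists (y + y'), (0 + w'); split.
  - by apply: subgroupD => //; rewrite -ji.
  - by apply: FinSumS hw'; exact: (sC i).1.
  - by rewrite add0r.
  - by rewrite add0r addrA.
exists y', (y + w'); split => //; [exact: FinSumS Cy hw'| |by rewrite addrCA].
by apply: (subgroupD sg) => //; apply: sub_gen; exists j.
Qed.

(** This says that some component of [v] is nonzero. Otherwise, write [v = y + w] and collect all
    terms from the [C i] containing [y]: their sum lies in [C i] and in its complement, so it is 0,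
    and [v] is a shorter sum. *)
Lemma direct_sum_neq0 (I : Type) (C : I -> set V) A v :
  direct_sum C A -> A v -> v <> 0 ->
  exists i, ~ gen (\bigcup_(j in [set~ i]) C j) v.
Proof.
move=> [sC dC ->] /(gen_fin_sum sC)[n hv] v0; apply: contrapT => /forallNP h.
elim: n v hv v0 h => [|n IH] v hv v0 h; first by case: v0; inversion hv.
inversion hv as [|m i y w Cy hw em ev]; subst m.
have [y' [w' [Cy' hw' gw' ew]]] := fin_sum_split i sC hw.
suff e : v = w' by apply: (IH v) => //; rewrite e.
suff: (C i `&` gen (\bigcup_(j in [set~ i]) C j)) (y + y').
  by rewrite dC => /= e; rewrite -ev ew addrA e add0r.
split; first exact: (subgroupD (sC i)).
have -> : y + y' = v - w' by rewrite -ev ew addrA addrK.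
by apply: (gen_subgroup _).2 => //; apply: contrapT => nv; exact: (h i nv).
Qed.

End DirectSums.

(** * Coordinates *)

Section Coordinates.
Set Implicit Arguments.
Unset Strict Implicit.
Variables (V : lmodType rat) (u x : nat -> V).
Implicit Types (v w : V) (a b c d : nat -> rat).

Definition comb a b (N : nat) : V := \sum_(n < N) (a n *: u n + b n *: x n).

Definition is_coords v a b : Prop :=
  exists2 N, (forall n, (N <= n)%N -> a n = 0 /\ b n = 0) & v = comb a b N.

Definition in_span v : Prop := exists ab, is_coords v ab.1 ab.2.

(** Coordinates are made total by the default 0 outside the span; inside it they are chosen, and
    independence makes the choice unique. *)
Definition coords v : (nat -> rat) * (nat -> rat) :=
  if pselect (in_span v) is left h then projT1 (cid h) else (fun=> 0, fun=> 0).

Definition ucoord v := (coords v).1.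
Definition xcoord v := (coords v).2.

Lemma comb_widen a b N M : (N <= M)%N ->
  (forall n, (N <= n)%N -> a n = 0 /\ b n = 0) -> comb a b N = comb a b M.
Proof.
move=> /subnKC <- h; elim: (M - N)%N => [|k IH]; first by rewrite addn0.
rewrite addnS /comb big_ord_recr /= -/(comb a b (N + k)) -IH.
by have [|-> ->] := h (N + k)%N; rewrite ?leq_addr // !scale0r !addr0.
Qed.

Lemma is_coordsB v w a b c d : is_coords v a b -> is_coords w c d ->
  is_coords (v - w) (fun n => a n - c n) (fun n => b n - d n).
Proof.
move=> [N hN ->] [M hM ->]; exists (maxn N M).
  by move=> n; rewrite geq_max => /andP[/hN[-> ->] /hM[-> ->]]; rewrite subrr.
rewrite (comb_widen (leq_maxl N M)) // (comb_widen (leq_maxr N M)) // -sumrB.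
by apply: eq_bigr => n _; rewrite !scalerBl opprD addrACA.
Qed.

Lemma is_coordsZ y v a b : is_coords v a b ->
  is_coords (y *: v) (fun n => y * a n) (fun n => y * b n).
Proof.
move=> [N hN ->]; exists N; first by move=> n /hN[-> ->]; rewrite mulr0.
by rewrite scaler_sumr; apply: eq_bigr => n _; rewrite scalerDr !scalerA.
Qed.

Lemma is_coords_comb1 m y z :
  is_coords (y *: u m + z *: x m) (fun n => if n == m then y else 0)
    (fun n => if n == m then z else 0).
Proof.
exists m.+1 => [n|]; first by case: eqP => // ->; rewrite ltnn.
rewrite /comb big_ord_recr /= eqxx big1 ?add0r // => i _.
by rewrite ltn_eqF // !scale0r addr0.
Qed.

Hypothesis indep : lin_independent (join_family u x).

Lemma is_coords0 a b n : is_coords 0 a b -> a n = 0 /\ b n = 0.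
Proof.
move=> [N hN /esym h]; case: (ltnP n N) => [nN|/hN //].
pose s : seq (nat + nat) := map inl (iota 0 N) ++ map inr (iota 0 N).
pose c (i : nat + nat) := match i with inl n => a n | inr n => b n end.
have us : uniq s.
  rewrite cat_uniq !map_inj_uniq ?iota_uniq /=; try by move=> ? ? [].
  by rewrite andbT; apply/hasPn => _ /mapP[k _ ->]; apply/mapP => -[].
have E : \sum_(i <- s) c i *: join_family u x i = 0.
  rewrite -[RHS]h big_cat !big_map /= /comb.
  rewrite -(big_mkord xpredT (fun n => a n *: u n + b n *: x n)).
  by rewrite big_split /= /index_iota subn0.
have nI : n \in iota 0 N by rewrite mem_iota.
by split; [apply: (indep us E (i := inl n))|apply: (indep us E (i := inr n))];
  rewrite mem_cat map_f ?orbT.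
Qed.

Lemma coordsP v a b : is_coords v a b -> ucoord v = a /\ xcoord v = b.
Proof.
move=> h; rewrite /ucoord /xcoord /coords; case: pselect; last first.
  by case; exists (a, b).
move=> h'; case: cid => -[c d] /= h''.
have := is_coordsB h'' h; rewrite subrr => e.
by split; apply/funext => n; have [e1 e2] := is_coords0 n e; apply/eqP;
  rewrite -subr_eq0 ?e1 ?e2.
Qed.

Lemma in_spanP v : in_span v -> is_coords v (ucoord v) (xcoord v).
Proof. by move=> [[a b] /= h]; have [-> ->] := coordsP h. Qed.

Lemma in_span_subgroup : is_subgroup in_span.
Proof.
split.
  by exists (fun=> 0, fun=> 0); exists 0%N => //; rewrite /comb big_ord0.
move=> v w [[a b] hv] [[c d] hw].
by eexists (_, _); exact: is_coordsB hv hw.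
Qed.

Lemma in_spanZ y v : in_span v -> in_span (y *: v).
Proof. by move=> [[a b] hv]; eexists (_, _); exact: is_coordsZ hv. Qed.

Lemma in_span_comb1 m y z : in_span (y *: u m + z *: x m).
Proof. by eexists (_, _); exact: is_coords_comb1. Qed.

Lemma coordB v w n : in_span v -> in_span w ->
  ucoord (v - w) n = ucoord v n - ucoord w n /\
  xcoord (v - w) n = xcoord v n - xcoord w n.
Proof.
by move=> /in_spanP hv /in_spanP hw; have [-> ->] := coordsP (is_coordsB hv hw).
Qed.

Lemma coordD v w n : in_span v -> in_span w ->
  ucoord (v + w) n = ucoord v n + ucoord w n /\
  xcoord (v + w) n = xcoord v n + xcoord w n.
Proof.
move=> hv hw; have S := in_span_subgroup.
have hNw : in_span (- w) by exact: subgroupN.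
have [e1 e2] := coordB n S.1 hw; have [e3 e4] := coordB n S.1 S.1.
have [e5 e6] := coordB n hv hNw.
move: e1 e2 e3 e4 e5 e6; rewrite opprK !sub0r oppr0 !subrr.
by move=> -> -> -> ->; rewrite !sub0r !opprK.
Qed.

Lemma coordZ y v n : in_span v ->
  ucoord (y *: v) n = y * ucoord v n /\ xcoord (y *: v) n = y * xcoord v n.
Proof. by move=> /in_spanP hv; have [-> ->] := coordsP (is_coordsZ y hv). Qed.

Lemma coord_comb1 m y z n :
  ucoord (y *: u m + z *: x m) n = (if n == m then y else 0) /\
  xcoord (y *: u m + z *: x m) n = (if n == m then z else 0).
Proof. by have [-> ->] := coordsP (is_coords_comb1 m y z). Qed.

Lemma coord_eq0 v : in_span v ->
  (forall n, ucoord v n = 0) -> (forall n, xcoord v n = 0) -> v = 0.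
Proof.
move=> /in_spanP[N _ e] hu hx; rewrite e /comb big1 // => i _.
by rewrite hu hx !scale0r addr0.
Qed.

Lemma coord_supp v : in_span v -> exists N, forall n, (N <= n)%N ->
  ucoord v n = 0 /\ xcoord v n = 0.
Proof. by move=> /in_spanP[N h _]; exists N. Qed.

Definition ucomb c N : V := \sum_(n < N) c n *: u n.

Lemma ucombP c N : (forall n, (N <= n)%N -> c n = 0) ->
  [/\ in_span (ucomb c N), ucoord (ucomb c N) = c & forall n, xcoord (ucomb c N) n = 0].
Proof.
move=> h; have hc : is_coords (ucomb c N) c (fun=> 0).
  exists N => [n /h //|]; apply: eq_bigr => i _; by rewrite scale0r addr0.
by have [-> ->] := coordsP hc; split => //; exists (c, fun=> 0).
Qed.

End Coordinates.

(** * The group *)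

Section RankOne.
Set Implicit Arguments.
Unset Strict Implicit.
Variable V : lmodType rat.

Lemma sum_oapp1 (v : 'I_1 -> V) b (c : option 'I_1 -> int) :
  \sum_i oapp v b i *~ c i = b *~ c None + v ord0 *~ c (Some ord0).
Proof.
rewrite (bigD1 None) //= (bigD1 (Some ord0)) //= big1 ?addr0 // => -[i|//].
by rewrite (ord1 i).
Qed.

(** By maximality, adjoining [b] to the independent element gives a nontrivial relation. The
    coefficient of [b] in it is nonzero, so the relation can be solved for [b]. *)
Lemma rank1_line (C : set V) : has_rank C 1 ->
  exists v, forall b, C b -> exists r : rat, b = r *: v.
Proof.
move=> [v [Cv iv hv]]; exists (v ord0) => b /hv /existsNP[c /not_implyP[]].
rewrite sum_oapp1 => e nc.
have c0 : c None != 0.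
  apply/eqP => c0; apply: nc => -[i|//]; rewrite (ord1 i).
  apply: (iv (fun i => c (Some i))).
  by rewrite big_ord1; move: e; rewrite c0 mulr0z add0r.
exists (- (c (Some ord0))%:~R / (c None)%:~R).
have cq : (c None)%:~R != 0 :> rat by rewrite intr_eq0.
apply: (scalerI cq); rewrite scalerA mulrCA mulfV // mulr1 scaleNr !scaler_int.
by apply/eqP; rewrite -addr_eq0 e.
Qed.

Lemma rank1_Zloc p (v : V) : prime p -> v <> 0 ->
  has_rank [set y *: v | y in Zloc p] 1.
Proof.
move=> pp v0; exists (fun=> v); split.
- by move=> _; exists 1; [apply: Zloc_int; rewrite rpred1|rewrite scale1r].
- move=> c; rewrite big_ord1 -scaler_int => /eqP.
  by rewrite scaler_eq0 intr_eq0 => /orP[/eqP c0 i|/eqP//]; rewrite (ord1 i).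
- move=> _ [y [k /intrP[z e]] <-] h.
  (* With [y * p ^ k = z], the dependence is [p ^ k] times the adjoined element minus [z] times
     [v]. *)
  have := h (fun i => if i is Some _ then - z else (p ^ k)%N%:Z).
  rewrite sum_oapp1 -!scaler_int scalerA -scalerDl.
  have -> : (p ^ k)%N%:Z%:~R * y + (- z)%:~R = 0 :> rat.
    by rewrite rmorphN /= -e -pmulrn natrX mulrC subrr.
  rewrite scale0r => /(_ erefl None) /eqP.
  by rewrite -[_ == 0]/((p ^ k)%N == 0%N) expn_eq0 andb_idr; move: (prime_gt0 pp); case: (p).
Qed.

End RankOne.

(** * Coordinates and divisibility in [G] *)

Section Group.
Set Implicit Arguments.
Unset Strict Implicit.
Variables (V : lmodType rat) (p : nat) (p_ q_ : nat -> nat) (u x : nat -> V).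
Hypotheses (pp : prime p) (pp_ : forall n, prime (p_ n))
  (pq_ : forall n, prime (q_ n)) (iq : injective q_) (ip : injective p_)
  (npp : forall n, p <> p_ n) (npq : forall n, p <> q_ n)
  (npq_ : forall m n, p_ m <> q_ n)
  (indep : lin_independent (join_family u x)).

Local Notation G := (gen (\bigcup_n Bgroup p p_ q_ u x n)).
Local Notation uc := (ucoord u x).
Local Notation xc := (xcoord u x).
Local Notation span := (in_span u x).

Lemma inf_div_sub_G n k : [/\ G (p%:R ^- k *: u n), G ((p_ n)%:R ^- k *: x n) &
  G ((q_ n)%:R^-1 *: (u n + x n))].
Proof.
have h v : Bgroup p p_ q_ u x n v -> G v by move=> hv; apply: sub_gen; exists n.
split; apply: h; apply: sub_gen.
- by left; left; exists k.
- by left; right; exists k.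
- by right.
Qed.

(** The integer [k] counts the occurrences of the generator (u_n + x_n)/q_n: it is 1 for that
    generator and 0 for the others. The point is that one [k] serves both coordinates, which couples
    them modulo [q_ n]. *)
Lemma G_coords v : G v -> span v /\ forall n, exists k : int,
  Zloc p (uc v n - k%:~R / (q_ n)%:R) /\ Zloc (p_ n) (xc v n - k%:~R / (q_ n)%:R).
Proof.
have Z0 r : Zloc r 0 by apply: Zloc_int; rewrite rpred0.
pose S := [set v | span v /\ forall n, exists k : int,
  Zloc p (uc v n - k%:~R / (q_ n)%:R) /\ Zloc (p_ n) (xc v n - k%:~R / (q_ n)%:R)].
have S1 m y z (k : int) : Zloc p (y - k%:~R / (q_ m)%:R) ->
    Zloc (p_ m) (z - k%:~R / (q_ m)%:R) -> S (y *: u m + z *: x m).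
  move=> hy hz; split=> [|n]; first exact: in_span_comb1.
  have [-> ->] := coord_comb1 indep m y z n.
  case: eqP => [->|_]; first by exists k.
  by exists 0; rewrite mul0r subr0.
have ZlocBB r (a b c d : rat) : Zloc r (a - b) -> Zloc r (c - d) ->
    Zloc r (a - c - (b - d)).
  move=> h1 h2; have -> : a - c - (b - d) = a - b - (c - d) by ring.
  exact: ZlocB.
have sS : is_subgroup S.
  split.
    by have := S1 0%N 0 0 0; rewrite !scale0r addr0 mul0r subr0; apply.
  move=> w w' [sw hw] [sw' hw']; split=> [|n]; first exact: ((in_span_subgroup u x).2 _ _ sw sw').
  have [-> ->] := coordB indep n sw sw'.
  have [k [h1 h2]] := hw n; have [l [h3 h4]] := hw' n.
  exists (k - l); rewrite rmorphB /= mulrBl.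
  by split; exact: ZlocBB.
suff h : G `<=` S by move=> /h.
apply: smallest_sub => // w [n _]; move: w; apply: smallest_sub => //.
move=> _ [[[k _ <-]|[k _ <-]]|->].
- rewrite -[X in S X]addr0 -(scale0r (x n)); apply: (S1 _ _ _ 0); rewrite mul0r subr0 //.
  exact: Zloc_expV.
- rewrite -[X in S X]add0r -(scale0r (u n)); apply: (S1 _ _ _ 0); rewrite mul0r subr0 //.
  exact: Zloc_expV.
- by rewrite scalerDr; apply: (S1 _ _ _ 1); rewrite mul1r subrr.
Qed.

Lemma G_span v : G v -> span v. Proof. by case/G_coords. Qed.

Lemma G_q_coord v n : G v ->
  Zloc p ((q_ n)%:R * uc v n) /\ Zloc (p_ n) ((q_ n)%:R * xc v n).
Proof.
move=> /G_coords[_ /(_ n)[k [h1 h2]]].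
have Zk r (y : rat) : Zloc r (y - k%:~R / (q_ n)%:R) -> Zloc r ((q_ n)%:R * y).
  move=> h; have -> : (q_ n)%:R * y = (q_ n)%:R * (y - k%:~R / (q_ n)%:R) + k%:~R.
    by have := prime_neq0 (pq_ n); move: (q_ n)%:R => Q Q0; field.
  apply: ZlocD; last by apply: Zloc_int; rewrite rpred_int.
  by apply: ZlocM => //; apply: Zloc_int; rewrite rpred_nat.
by split; apply: Zk.
Qed.

Lemma Zloc_shift r n (k : int) y : ((q_ n)%:Z %| k)%Z ->
  Zloc r (y - k%:~R / (q_ n)%:R) -> Zloc r y.
Proof.
move=> /dvdzP[z ->] h; rewrite -[y](subrK ((z * q_ n)%:~R / (q_ n)%:R)).
apply: ZlocD => //; apply: Zloc_int.
by rewrite rmorphM /= -pmulrn mulfK ?rpred_int // prime_neq0.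
Qed.

Lemma Zloc_opp_div r n (k : int) : prime r -> r <> q_ n ->
  Zloc r (0 - k%:~R / (q_ n)%:R) -> ((q_ n)%:Z %| k)%Z.
Proof.
move=> pr rq h; apply: (Zloc_divP pr (pq_ n) rq).
have Z0 : Zloc r 0 by apply: Zloc_int; rewrite rpred0.
by have := ZlocB Z0 h; rewrite !sub0r opprK.
Qed.

(** A zero coordinate at [x n] puts k/q_n into Z[1/p_n]. This forces [q_ n] to divide [k], and the
    fractional correction disappears from the other coordinate too. *)
Lemma G_ucoord v n : G v -> xc v n = 0 -> Zloc p (uc v n).
Proof.
move=> /G_coords[_ /(_ n)[k [h1 h2]]] e; rewrite e in h2.
by apply: Zloc_shift h1; apply: Zloc_opp_div h2.
Qed.

Lemma G_xcoord v n : G v -> uc v n = 0 -> Zloc (p_ n) (xc v n).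
Proof.
move=> /G_coords[_ /(_ n)[k [h1 h2]]] e; rewrite e in h1.
by apply: Zloc_shift h2; apply: Zloc_opp_div h1.
Qed.

(** Up to the factor [q_ n], the coordinate at [x n] lies in Z[1/p_n], where only 0 is divisible by
    all powers of the different prime [p]. *)
Lemma inf_p_divisible v : (forall k, G (p%:R ^- k *: v)) -> forall n, xc v n = 0.
Proof.
move=> h n; have Gv : G v by have := h 0%N; rewrite expr0 invr1 scale1r.
suff /eqP : (q_ n)%:R * xc v n = 0.
  by rewrite mulf_eq0 (negbTE (prime_neq0 (pq_ n))) => /eqP.
apply: (@Zloc_inf_div p (p_ n)) => // k.
have [_] := G_q_coord n (h k).
by have [_ ->] := coordZ indep (p%:R ^- k) n (G_span Gv); rewrite mulrCA.
Qed.

(** The same argument kills every coordinate except the one at [x n], the only one whose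
    denominators may contain high powers of [p_ n]. *)
Lemma inf_p_n_divisible v n : (forall k, G ((p_ n)%:R ^- k *: v)) ->
  v = xc v n *: x n.
Proof.
move=> h; have Gv : G v by have := h 0%N; rewrite expr0 invr1 scale1r.
have hq m y : (q_ m)%:R * y = 0 -> y = 0 :> rat.
  by move/eqP; rewrite mulf_eq0 (negbTE (prime_neq0 (pq_ m))) => /eqP.
have uc0 m : uc v m = 0.
  apply: (hq m); apply: (@Zloc_inf_div (p_ n) p) => // [|k]; first exact/nesym.
  have [+ _] := G_q_coord m (h k).
  by have [-> _] := coordZ indep ((p_ n)%:R ^- k) m (G_span Gv); rewrite mulrCA.
have xc0 m : m <> n -> xc v m = 0.
  move=> mn; apply: (hq m); apply: (@Zloc_inf_div (p_ n) (p_ m)) => // [/ip/esym //|k].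
  have [_] := G_q_coord m (h k).
  by have [_ ->] := coordZ indep ((p_ n)%:R ^- k) m (G_span Gv); rewrite mulrCA.
have e : xc v n *: x n = 0 *: u n + xc v n *: x n by rewrite scale0r add0r.
have s1 := in_span_comb1 u x n 0 (xc v n).
apply/eqP; rewrite -subr_eq0; apply/eqP; rewrite {1}e.
apply: (coord_eq0 indep) => [|m|m].
- exact: ((in_span_subgroup u x).2 _ _ (G_span Gv) s1).
- have [-> _] := coordB indep m (G_span Gv) s1.
  by have [-> _] := coord_comb1 indep n 0 (xc v n) m; rewrite uc0 if_same subrr.
- have [_ ->] := coordB indep m (G_span Gv) s1.
  have [_ ->] := coord_comb1 indep n 0 (xc v n) m.
  by case: eqP => [->|/xc0 ->]; rewrite subrr.
Qed.

Lemma G_ucomb a N : (forall n, Zloc p (a n)) -> G (ucomb u a N).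
Proof.
move=> h; apply: (@subgroup_sum _ _ _ (fun n => a n *: u n)); first exact: gen_subgroup.
move=> n; have [k /intrP[z e]] := h n.
have -> : a n = z%:~R * p%:R ^- k by rewrite -e mulfK // expf_neq0 // prime_neq0.
rewrite -scalerA; apply: (subgroupMz z (gen_subgroup _)).
by have [] := inf_div_sub_G n k.
Qed.

Lemma direct_sum2_inf_div A H r a h : prime r -> direct_sum2 A H G -> A a -> H h ->
  (forall k, G (r%:R ^- k *: (a + h))) -> forall k, A (r%:R ^- k *: a).
Proof.
move=> pr D Aa Hh hG k.
have e : (r%:R ^+ k : rat) = (r ^ k)%N%:Z%:~R by rewrite -pmulrn natrX.
have := hG k; rewrite e => hk.
have [|//] := direct_sum2_scaleV D _ Aa Hh hk.
by rewrite -lt0n expn_gt0 prime_gt0.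
Qed.

Lemma x_neq0 n : x n <> 0.
Proof.
move=> xn; have := indep (s := [:: inr n]) (c := fun=> 1) isT.
rewrite big_seq1 /= xn scaler0 => /(_ erefl (inr n)).
by rewrite mem_head => /(_ isT)/eqP; rewrite oner_eq0.
Qed.

(** An element is recovered from the finite list of its coordinate pairs, and there are countably
    many lists of pairs of rationals. *)
Lemma countable_G : countable G.
Proof.
pose F (l : seq (rat * rat)) :=
  comb u x (fun n => (nth (0, 0) l n).1) (fun n => (nth (0, 0) l n).2) (size l).
suff h : G `<=` F @` [set: seq (rat * rat)].
  apply: sub_countable (subset_card_le h) _.
  by apply: sub_countable (card_image_le _ _) _; exact: countableP.
move=> v /G_span/(in_spanP indep)[N _ ->].
exists [seq (uc v n, xc v n) | n <- iota 0 N] => //.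
rewrite /F size_map size_iota; apply: eq_bigr => i _.
by rewrite (nth_map 0%N) ?size_iota // nth_iota.
Qed.

Lemma Zloc_qV r n : prime r -> r <> q_ n -> ~ Zloc r (q_ n)%:R^-1.
Proof.
move=> pr rq h; have := @Zloc_divP r (q_ n) 1 pr (pq_ n) rq.
rewrite mul1r => /(_ h); rewrite dvdzE /= dvdn1 => /eqP q1.
by have := pq_ n; rewrite q1.
Qed.

(** The component [b] inherits divisibility by all powers of [p_ n], so it is a nonzero rational
    multiple of [x n]; purity of the summand [B] then brings [x n] into it. *)
Lemma summand_inf_multiple B K n b k :
  direct_sum2 B K G -> B b -> K k ->
  x n = b + k -> b <> 0 -> B (x n).
Proof.
move=> DB Bb Kk e b0.
have Gx j : G ((p_ n)%:R ^- j *: x n) by have [] := inf_div_sub_G n j.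
have hb : b = xc b n *: x n.
  apply: inf_p_n_divisible => j; apply: (direct_sum2_sub DB).
  by apply: (direct_sum2_inf_div (pp_ n) DB Bb Kk) => {}j; rewrite -e.
have g0 : xc b n != 0 by apply/eqP => g0; apply: b0; rewrite hb g0 scale0r.
have ex : x n = (xc b n)^-1 *: b by rewrite {2}hb scalerA mulVf // scale1r.
rewrite ex; apply: (direct_sum2_pure DB Bb); rewrite -ex.
by have := Gx 0%N; rewrite expr0 invr1 scale1r.
Qed.

(** * Decompositions of [G] into two summands *)

Section Summands.
Variables A H : set V.
Hypothesis D : direct_sum2 A H G.

Let GE v : G v -> exists a h, [/\ A a, H h & v = a + h].
Proof. by have [_ _ _ ->] := D; move=> [a Aa [h Hh <-]]; exists a, h. Qed.

Lemma x_in_summand n : A (x n) \/ H (x n).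
Proof.
have Gx : G (x n).
  by have [_ + _] := inf_div_sub_G n 0; rewrite expr0 invr1 scale1r.
have [a [h [Aa Hh e]]] := GE Gx.
have [a0|a0] := pselect (a = 0); first by right; rewrite e a0 add0r.
by left; apply: (summand_inf_multiple D Aa Hh e a0).
Qed.

Lemma x_notin_completely_decomposable n : completely_decomposable A -> ~ A (x n).
Proof.
move=> [I [C [rk ds]]] Ax.
(* Choose [i] such that [x n] has a nonzero component in [C i]; this rank one summand of [G] then
   contains [x n]. *)
have [i ni] := direct_sum_neq0 ds Ax (@x_neq0 n).
have D1 := direct_sum_split i ds; have D2 := direct_sum2A D1 D.
set K := [set k + h | k in _ & h in H] in D2.
have [sC sK _ AE] := D1.
have Cx : C i (x n).
  move: (Ax); rewrite AE => -[c Cc [k Kk /esym e]].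
  have [_ sH _ _] := D.
  apply: (summand_inf_multiple D2 Cc _ e).
    by exists k => //; exists 0; [exact: sH.1|rewrite addr0].
  by move=> c0; apply: ni; rewrite e c0 add0r.
have [v0 hv0] := rank1_line (rk i).
have [s xs] := hv0 _ Cx.
have s0 : s != 0 by apply/eqP => s0; apply: (@x_neq0 n); rewrite xs s0 scale0r.
have Gu k : G (p%:R ^- k *: u n) by have [] := inf_div_sub_G n k.
have [y Cy [k Kk /esym e]] : [set c + k | c in C i & k in K] (u n).
  have [_ _ _ <-] := D2.
  by have := Gu 0%N; rewrite expr0 invr1 scale1r.
(* As [C i] has rank one, [y] is a multiple of [x n]; divisibility by all powers of [p] makes its
   coordinate there vanish. *)
have y0 : y = 0.
  have ydiv j : G (p%:R ^- j *: y).
    apply: (direct_sum2_sub D2).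
    by apply: (direct_sum2_inf_div pp D2 Cy Kk) => {}j; rewrite -e.
  have [r yr] := hv0 _ Cy.
  have yx : y = 0 *: u n + (r / s) *: x n by rewrite scale0r add0r xs scalerA divfK.
  have := inf_p_divisible ydiv n; rewrite {1}yx.
  have [_ ->] := coord_comb1 indep n 0 (r / s) n.
  by rewrite eqxx yx => ->; rewrite !scale0r addr0.
(* With [u n = k], the component of (u_n + x_n)/q_n in [C i] is x_n/q_n, which is not in [G]. *)
have Gg : G ((q_ n)%:Z%:~R^-1 *: (x n + k)).
  have [_ _] := inf_div_sub_G n 0.
  by rewrite -pmulrn {1}e y0 add0r [k + _]addrC.
have q0 : (q_ n)%:Z != 0 by rewrite -lt0n prime_gt0.
have [Cq _] := direct_sum2_scaleV D2 q0 Cx Kk Gg.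
have Gq := direct_sum2_sub D2 Cq.
move: Gq; rewrite -pmulrn -[_ *: _]add0r -(scale0r (u n)) => Gq.
have [eu ex] := coord_comb1 indep n 0 (q_ n)%:R^-1 n; rewrite eqxx in eu ex.
have := G_xcoord Gq eu; rewrite ex; exact: Zloc_qV.
Qed.

Hypothesis Hx : forall n, H (x n).

(** Take [h] to be the component of [u n] in [H]. If its coordinate at [u n] were 0, that of [a]
    would be 1; since [x n] is in [H], the component of (u_n + x_n)/q_n in [A] would be a/q_n, with
    coordinates 1/q_n at [u n] and 0 at [x n]. *)
Lemma complement_ucoord_neq0 n :
  exists h, [/\ H h, forall m, xc h m = 0 & uc h n != 0].
Proof.
have Gu k : G (p%:R ^- k *: u n) by have [] := inf_div_sub_G n k.
have Gu0 : G (u n) by have := Gu 0%N; rewrite expr0 invr1 scale1r.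
have [a [h [Aa Hh e]]] := GE Gu0.
have [sA sH _ _] := D.
have xa : forall m, xc a m = 0.
  apply: inf_p_divisible => j; apply: (direct_sum2_sub D).
  by apply: (direct_sum2_inf_div pp D Aa Hh) => {}j; rewrite -e.
have xh : forall m, xc h m = 0.
  apply: inf_p_divisible => j; apply: (direct_sum2_subr D).
  by apply: (direct_sum2_inf_div pp (direct_sum2C D) Hh Aa) => {}j; rewrite addrC -e.
exists h; split => //; apply/eqP => h0.
have Gg : G ((q_ n)%:Z%:~R^-1 *: (a + (h + x n))).
  by have [_ _] := inf_div_sub_G n 0; rewrite -pmulrn addrA -e.
have q0 : (q_ n)%:Z != 0 by rewrite -lt0n prime_gt0.
have [Aq _] := direct_sum2_scaleV D q0 Aa (subgroupD sH Hh (Hx n)) Gg.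
have Sa := G_span (direct_sum2_sub D Aa); have Sh := G_span (direct_sum2_subr D Hh).
have ua : uc a n = 1.
  have [] := coordD indep n Sa Sh; rewrite -e h0 addr0 => <- _.
  by have [] := coord_comb1 indep n 1 0 n; rewrite eqxx scale1r scale0r addr0.
have [e1 e2] := coordZ indep (q_ n)%:R^-1 n Sa.
have := G_ucoord (direct_sum2_sub D Aq) (n := n).
by rewrite -pmulrn e1 e2 xa mulr0 ua mulr1 => /(_ erefl); exact: Zloc_qV.
Qed.

Lemma complement_unimodular : exists (w D : nat -> int) M,
  [/\ H (ucomb u (fun n => (w n)%:~R) M), forall n, (M <= n)%N -> w n = 0 &
      \sum_(n < M) (q_ n)%:Z * w n * D n = 1].
Proof.
(* The free rational factor [y] makes [W] a rational vector space, although [H] is only a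
   subgroup. *)
pose W := [set f : nat -> rat | exists y h,
  [/\ H h, forall m, xc h m = 0 & f = fun n => y * uc h n]].
have [_ sH _ _] := D.
have HS h : H h -> span h by move=> /(direct_sum2_subr D)/G_span.
have [|||w [E [M [[y [h [Hh xh ew]]] wM sum1]]]] := @exists_unimodular q_ W pq_ iq.
- move=> _ [y [h [/HS /(coord_supp indep)[N hN] _ ->]]]; exists N => n /hN[-> _].
  by rewrite mulr0.
- move=> a b _ _ [y [h [Hh xh ->]]] [z [k [Hk xk ->]]].
  have hd (r : rat) : (denq r)%:~R != 0 :> rat by rewrite intr_eq0 denq_neq0.
  (* Over the common denominator of [a * y] and [b * z] their numerators are [i] and [j], so an
     integral combination of [h] and [k] stays in [H]. *)
  pose i := numq (a * y) * denq (b * z); pose j := numq (b * z) * denq (a * y).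
  have Si := in_spanZ i%:~R (HS _ Hh); have Sj := in_spanZ j%:~R (HS _ Hk).
  exists ((denq (a * y) * denq (b * z))%:~R^-1), (i%:~R *: h + j%:~R *: k); split.
  + by apply: (subgroupD sH); exact: (subgroupMz _ sH).
  + move=> m; have [_ ->] := coordD indep m Si Sj.
    have [_ ->] := coordZ indep i%:~R m (HS _ Hh).
    have [_ ->] := coordZ indep j%:~R m (HS _ Hk).
    by rewrite xh xk !mulr0 addr0.
  + apply/funext => m; have [-> _] := coordD indep m Si Sj.
    have [-> _] := coordZ indep i%:~R m (HS _ Hh).
    have [-> _] := coordZ indep j%:~R m (HS _ Hk).
    rewrite !mulrA -{1}(divq_num_den (a * y)) -{1}(divq_num_den (b * z)) /i /j !rmorphM /=.
    have := hd (a * y); have := hd (b * z); move: (denq _)%:~R (denq _)%:~R => Q1 Q2 Q10 Q20.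
    by field; rewrite Q10 Q20.
- move=> n; have [h [Hh xh h0]] := complement_ucoord_neq0 n.
  by exists (fun m => 1 * uc h m); [exists 1, h|rewrite mul1r].
exists w, E, M; split => //.
set f := fun n => _ in ew *.
have f0 n : (M <= n)%N -> f n = 0 by move=> /wM; rewrite /f => ->.
have [Sf uf xf] := ucombP indep f0.
have ef : ucomb u f M = y *: h.
  apply/eqP; rewrite -subr_eq0; apply/eqP.
  have Sy := in_spanZ y (HS _ Hh).
  apply: (coord_eq0 indep) => [|n|n]; first exact: ((in_span_subgroup u x).2 _ _ Sf Sy).
    have [-> _] := coordB indep n Sf Sy; have [-> _] := coordZ indep y n (HS _ Hh).
    by rewrite uf ew subrr.
  have [_ ->] := coordB indep n Sf Sy; have [_ ->] := coordZ indep y n (HS _ Hh).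
  by rewrite xf xh mulr0 subrr.
(* An integral combination of the [u n] lies in [G]; being a rational multiple of [h], it lies in
   [H] by purity. *)
rewrite ef; apply: (direct_sum2_pure (direct_sum2C D) Hh); rewrite -ef.
by apply: G_ucomb => n; apply: Zloc_int; rewrite rpred_int.
Qed.

Lemma complement_not_clipped : ~ clipped H.
Proof.
have [w [E [M [Hw wM sum1]]]] := complement_unimodular.
have [_ sH _ _] := D; have DH := direct_sum2C D.
have HS h : H h -> span h by move=> /(direct_sum2_sub DH)/G_span.
set f := fun n => _ in Hw; set v := ucomb u f M in Hw.
have f0 n : (M <= n)%N -> f n = 0 by move=> /wM; rewrite /f => ->.
have [Sv uv xv] := ucombP indep f0; rewrite -/v in Sv uv xv.
(* The factor [q_ n] keeps the values in Z[1/p] on all of [G], including the generators (u_n +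
   x_n)/q_n; unimodularity of [w] says that [Psi v = 1]. *)
pose Psi g : rat := \sum_(n < M) ((q_ n)%:R * uc g n) * (E n)%:~R.
have PsiB g k : span g -> span k -> Psi (g - k) = Psi g - Psi k.
  move=> Sg Sk; rewrite -sumrB; apply: eq_bigr => n _.
  by have [-> _] := coordB indep n Sg Sk; ring.
have PsiZ y g : span g -> Psi (y *: g) = y * Psi g.
  move=> Sg; rewrite mulr_sumr; apply: eq_bigr => n _.
  by have [-> _] := coordZ indep y n Sg; ring.
have Psiv : Psi v = 1.
  rewrite -[RHS]/(1%:~R) -sum1 rmorph_sum; apply: eq_bigr => n _.
  by rewrite uv !rmorphM.
have ZPsi g : G g -> Zloc p (Psi g).
  move=> Gg; apply: (@Zloc_sum p M (fun n => ((q_ n)%:R * uc g n) * (E n)%:~R)) => n _.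
  apply: ZlocM; first by have [] := G_q_coord n Gg.
  by apply: Zloc_int; rewrite rpred_int.
have v0 : v <> 0.
  move=> v0; have := PsiZ 0 v Sv; rewrite scale0r -v0 Psiv mul0r => /eqP.
  by rewrite oner_eq0.
have Hyv y : Zloc p y -> H (y *: v).
  move=> Zy; apply: (direct_sum2_pure DH Hw).
  have -> : y *: v = ucomb u (fun n => y * f n) M.
    by rewrite /v /ucomb scaler_sumr; apply: eq_bigr => n _; rewrite scalerA.
  apply: G_ucomb => n; apply: ZlocM => //; apply: Zloc_int; exact: rpred_int.
(* [K] is the kernel of [Psi] on [H], and [h] splits as [Psi h *: v] plus an element of [K]. *)
pose C := [set y *: v | y in Zloc p]; pose K := [set h | H h /\ Psi h = 0].
have Z0 : Zloc p 0 by apply: Zloc_int; rewrite rpred0.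
have Z1 : Zloc p 1 by apply: Zloc_int; rewrite rpred1.
have Psi0 : Psi 0 = 0 by rewrite -(scale0r v) PsiZ // mul0r.
move=> /(_ C)[]; last exact: rank1_Zloc.
exists K; split.
- split; first by exists 0; rewrite ?scale0r.
  move=> _ _ [y Zy <-] [z Zz <-]; exists (y - z); first exact: ZlocB.
  by rewrite scalerBl.
- split; first by split; [exact: sH.1|].
  move=> h k [Hh h0] [Hk k0]; split; first exact: sH.2.
  by rewrite PsiB ?h0 ?k0 ?subrr //; exact: HS.
- apply/seteqP; split=> [_ [[y Zy <-] [_]]|_ ->].
    by rewrite PsiZ // Psiv mulr1 => ->; rewrite /= scale0r.
  by split; [exists 0; rewrite ?scale0r|split; [exact: sH.1|]].
- apply/seteqP; split=> [h Hh|_ [_ [y Zy <-] [k [Hk _] <-]]]; last first.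
    by apply: (subgroupD sH) => //; exact: Hyv.
  have Zh := ZPsi h (direct_sum2_sub DH Hh).
  exists (Psi h *: v); first by exists (Psi h).
  exists (h - Psi h *: v); last by rewrite addrC subrK.
  split; first by apply: sH.2 => //; exact: Hyv.
  rewrite PsiB ?PsiZ ?Psiv ?mulr1 ?subrr //; first exact: HS.
  exact: in_spanZ.
Qed.

End Summands.
End Group.

Theorem theorem2p23 (V : lmodType rat) (p : nat) (p_ q_ : nat -> nat)
    (u x : nat -> V) (G : set V) :
  prime p -> (forall n, prime (p_ n)) -> (forall n, prime (q_ n)) ->
  injective p_ -> injective q_ ->
  (forall n, p <> p_ n) -> (forall n, p <> q_ n) ->
  (forall m n, p_ m <> q_ n) ->
  lin_independent (join_family u x) ->
  direct_sum (Bgroup p p_ q_ u x) G ->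
  countable G /\ ~ (exists A H : set V, main_decomposition G A H).
Proof.
move=> pp pp_ pq_ ip iq npp npq npq_ indep [_ _ ->].
split; first exact: countable_G.
move=> [A [H [D cdA clH]]].
have Hx n : H (x n).
  have [Ax|//] := x_in_summand pp pp_ pq_ ip npp indep D n.
  case: (x_notin_completely_decomposable pp pp_ pq_ ip npp npq npq_ indep D cdA Ax).
exact: (complement_not_clipped pp pp_ pq_ iq npp npq npq_ indep D Hx clH).
Qed.
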